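(* Let $n\ge 2$ and let $\hat\eta: SVB_n\to\mathbb Z[VB_n]$ be the desingularization map. For every $a\in\mathbb Z$ (identified with $a\cdot 1\in\mathbb Z[VB_n]$), $$\hat\eta^{-1}(\{a\})=\begin{cases}\{1\} & \text{if } a=1,\\ \emptyset & \text{otherwise.}\end{cases}$$
   Context: Let $n\ge 2$. Consider the following relations, where indices range over $\{1,\dots,n-1\}$ unless otherwise indicated. (R0) $\sigma_i\sigma_j=\sigma_j\sigma_i$ for $|i-j|\ge 2$; (R2) $\sigma_i\sigma_i^{-1}=1=\sigma_i^{-1}\sigma_i$; (R3) $\sigma_i\sigma_{i+1}\sigma_i=\sigma_{i+1}\sigma_i\sigma_{i+1}$ for $i=1,\dots,n-2$; (V1) $\rho_i\rho_j=\rho_j\rho_i$ for $|i-j|\ge 2$; (V2) $\sigma_i\rho_j=\rho_j\sigma_i$ for $|i-j|\ge 2$; (V3) $\rho_i^2=1$; (V4) $\rho_i\rho_{i+1}\rho_i=\rho_{i+1}\rho_i\rho_{i+1}$ for $i=1,\dots,n-2$; (V5) $\rho_i\sigma_{i+1}\rho_i=\rho_{i+1}\sigma_i\rho_{i+1}$ for $i=1,\dots,n-2$; (S1) $\tau_i\tau_j=\tau_j\tau_i$ for $|i-j|\ge 2$; (S2) $\tau_i\sigma_j=\sigma_j\tau_i$ for $|i-j|\ge 2$; (S3) $\tau_i\sigma_i=\sigma_i\tau_i$; (S4) $\sigma_i\sigma_{i+1}\tau_i=\tau_{i+1}\sigma_i\sigma_{i+1}$ for $i=1,\dots,n-2$;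 (SV1) $\rho_i\tau_j=\tau_j\rho_i$ for $|i-j|\ge 2$; (SV2) $\rho_i\tau_{i+1}\rho_i=\rho_{i+1}\tau_i\rho_{i+1}$ for $i=1,\dots,n-2$. The virtual braid group $VB_n$ is the group generated by $\sigma_1,\dots,\sigma_{n-1},\rho_1,\dots,\rho_{n-1}$ with relations (R0), (R3), (V1)-(V5). The singular virtual braid monoid $SVB_n$ is the monoid generated by $\sigma_i^{\pm1},\rho_i,\tau_i$ ($1\le i\le n-1$) with relations (R0), (R2), (R3), (S1)-(S4), (V1)-(V5), (SV1), (SV2). $\mathbb Z[VB_n]$ is the integral group ring of $VB_n$. The desingularization map $\hat\eta:SVB_n\to\mathbb Z[VB_n]$ is the multiplicative monoid homomorphism defined by $\hat\eta(\sigma_i^{\pm1})=\sigma_i^{\pm1}$, $\hat\eta(\rho_i)=\rho_i$, $\hat\eta(\tau_i)=\sigma_i-\sigma_i^{-1}$. *)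

(* Defs.v *)
From HB Require Import structures.
From mathcomp Require Import all_boot all_order all_algebra.
From mathcomp Require Import finmap boolp classical_sets.
From mathcomp Require Import monalg.

Set Implicit Arguments.
Unset Strict Implicit.
Unset Printing Implicit Defensive.

Import GRing.Theory.

Local Open Scope ring_scope.
Local Open Scope quotient_scope.

(** * Monoids and groups given by presentations *)

(* The least congruence on the free monoid [seq A] containing [R]. *)
Inductive word_cong (A : Type) (R : seq A -> seq A -> Prop) :
    seq A -> seq A -> Prop :=
| word_cong_rel u v : R u v -> word_cong R u v
| word_cong_refl u : word_cong R u u
| word_cong_sym u v : word_cong R u v -> word_cong R v u
| word_cong_trans v u w :
    word_cong R u v -> word_cong R v w -> word_cong R u w
| word_cong_cat u u' v v' :
    word_cong R u u' -> word_cong R v v' -> word_cong R (u ++ v) (u' ++ v').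

Section PresentedMonoid.
Context (A : choiceType) (R : seq A -> seq A -> Prop).

(* [word_cong R] need not be decidable: it is turned into a boolean relation
   classically. *)
Definition word_congb (u v : seq A) : bool := `[< word_cong R u v >].

Lemma word_congb_refl : reflexive word_congb.
Proof. by move=> u; apply/asboolP; apply: word_cong_refl. Qed.

Lemma word_congb_sym : symmetric word_congb.
Proof.
by move=> u v; apply/asboolP/asboolP; apply: word_cong_sym.
Qed.

Lemma word_congb_trans : transitive word_congb.
Proof.
move=> v u w /asboolP uv /asboolP vw; apply/asboolP.
exact: word_cong_trans uv vw.
Qed.

Canonical word_congb_equiv :=
  EquivRel word_congb word_congb_refl word_congb_sym word_congb_trans.

Definition presented_monoid := {eq_quot word_congb}.

HB.instance Definition _ := Choice.on presented_monoid.
HB.instance Definition _ := EqQuotient.on presented_monoid.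

Definition word_class (u : seq A) : presented_monoid := \pi u.

Lemma word_classP u v : word_class u = word_class v <-> word_cong R u v.
Proof.
split=> [/eqmodP/asboolP //|uv].
by apply/eqmodP/asboolP.
Qed.

Lemma word_class_repr x : word_class (repr x) = x.
Proof. exact: reprK. Qed.

Lemma word_cong_repr u : word_cong R (repr (word_class u)) u.
Proof. by apply/word_classP; rewrite word_class_repr. Qed.

Definition pmul (x y : presented_monoid) : presented_monoid :=
  word_class (repr x ++ repr y).

Definition pone : presented_monoid := word_class [::].

Lemma pmul_class u v : pmul (word_class u) (word_class v) = word_class (u ++ v).
Proof. by apply/word_classP; apply: word_cong_cat; apply: word_cong_repr. Qed.

Fact pmulA : associative pmul.
Proof.
move=> x y z.
rewrite -(word_class_repr x) -(word_class_repr y) -(word_class_repr z).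
by rewrite !pmul_class catA.
Qed.

Fact pmul1 : left_id pone pmul.
Proof. by move=> x; rewrite -(word_class_repr x) pmul_class. Qed.

Fact pmulr1 : right_id pone pmul.
Proof. by move=> x; rewrite -(word_class_repr x) pmul_class cats0. Qed.

HB.instance Definition _ :=
  isMonoid.Build presented_monoid pmulA pmul1 pmulr1.

Lemma word_class_cat u v : word_class (u ++ v) = (word_class u * word_class v)%g.
Proof. by rewrite -pmul_class. Qed.

Lemma word_class_nil : word_class [::] = 1%g.
Proof. by []. Qed.

Lemma word_class_prod u :
  word_class u = (\prod_(a <- u) word_class [:: a])%g.
Proof.
elim: u => [|a u IHu]; first by rewrite big_nil.
by rewrite big_cons -IHu -word_class_cat.
Qed.

End PresentedMonoid.

(* In a presentation of a group, words are written in signed letters: [(a, true)]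
   stands for the generator [a] and [(a, false)] for its inverse. *)
Definition inv_word (A : Type) (u : seq (A * bool)) : seq (A * bool) :=
  rev [seq (x.1, ~~ x.2) | x <- u].

Inductive group_rel (A : Type)
    (R : seq (A * bool) -> seq (A * bool) -> Prop) :
    seq (A * bool) -> seq (A * bool) -> Prop :=
| group_rel_gen u v : R u v -> group_rel R u v
| group_rel_cancel a (b : bool) : group_rel R [:: (a, b); (a, ~~ b)] [::].

Section PresentedGroup.
Context (A : choiceType) (R : seq (A * bool) -> seq (A * bool) -> Prop).

Definition presented_group := presented_monoid (group_rel R).

HB.instance Definition _ := Choice.on presented_group.

Local Notation cong := (word_cong (group_rel R)).

Lemma inv_word_cat (u v : seq (A * bool)) :
  inv_word (u ++ v) = inv_word v ++ inv_word u.
Proof. by rewrite /inv_word map_cat rev_cat. Qed.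

Lemma inv_wordK : involutive (@inv_word A).
Proof.
move=> u; rewrite /inv_word map_rev revK -map_comp -[RHS]map_id.
by apply: eq_map => -[a b] /=; rewrite negbK.
Qed.

Lemma cat_inv_word (u : seq (A * bool)) : cong (u ++ inv_word u) [::].
Proof.
elim: u => [|[a b] u IHu]; first exact: word_cong_refl.
rewrite -cat1s inv_word_cat catA -(catA _ u).
apply: (@word_cong_trans _ _ (([:: (a, b)] ++ [::]) ++ [:: (a, ~~ b)])).
  apply: word_cong_cat; last exact: word_cong_refl.
  by apply: word_cong_cat => //; apply: word_cong_refl.
exact/word_cong_rel/group_rel_cancel.
Qed.

Lemma inv_word_catr (u : seq (A * bool)) : cong (inv_word u ++ u) [::].
Proof. by have := cat_inv_word (inv_word u); rewrite inv_wordK. Qed.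

Lemma inv_word_cong u v : cong u v -> cong (inv_word u) (inv_word v).
Proof.
move=> uv; have refl := @word_cong_refl _ (group_rel R).
apply: (@word_cong_trans _ _ (inv_word u ++ (v ++ inv_word v))).
  rewrite -[X in cong X _]cats0; apply: word_cong_cat => //.
  exact/word_cong_sym/cat_inv_word.
apply: (@word_cong_trans _ _ ((inv_word u ++ u) ++ inv_word v)).
  rewrite catA; apply: word_cong_cat => //; apply: word_cong_cat => //.
  exact: word_cong_sym.
rewrite -[X in cong _ X]cat0s; apply: word_cong_cat => //.
exact: inv_word_catr.
Qed.

Definition pinv (x : presented_group) : presented_group :=
  word_class (group_rel R) (inv_word (repr x)).

Lemma pinv_class u :
  pinv (word_class (group_rel R) u) = word_class (group_rel R) (inv_word u).
Proof. by apply/word_classP/inv_word_cong/word_cong_repr. Qed.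

Fact pmulVg : left_inverse (@pone _ (group_rel R)) pinv (@pmul _ (group_rel R)).
Proof.
move=> x; rewrite -(word_class_repr x) pinv_class pmul_class.
exact/word_classP/inv_word_catr.
Qed.

Fact pmulgV : right_inverse (@pone _ (group_rel R)) pinv (@pmul _ (group_rel R)).
Proof.
move=> x; rewrite -(word_class_repr x) pinv_class pmul_class.
exact/word_classP/cat_inv_word.
Qed.

HB.instance Definition _ :=
  isGroup.Build presented_group (@pmulA _ _) (@pmul1 _ _) (@pmulr1 _ _)
    pmulVg pmulgV.

Definition group_gen (a : A) : presented_group :=
  word_class (group_rel R) [:: (a, true)].

Lemma group_genV a :
  ((group_gen a)^-1)%g = word_class (group_rel R) [:: (a, false)].
Proof. exact: pinv_class. Qed.

End PresentedGroup.

(** * Group rings *)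

(* The finitely supported functions [G -> R] with the convolution product; the
   ring structure that [monalg] puts on [{malg R[K]}] is not applicable, as a
   [monomType] has no units besides 1. *)
Definition group_ring (R : nzRingType) (G : groupType) := {malg R[G]}.

Section GroupRing.
Context (R : nzRingType) (G : groupType).
Local Notation RG := (group_ring R G).

HB.instance Definition _ := GRing.Zmodule.on RG.

Definition grU (c : R) (x : G) : RG := mkmalgU x c.

Definition gr1 : RG := grU 1 1%g.

Definition grmul (f g : RG) : RG :=
  \sum_(x <- msupp f) \sum_(y <- msupp g)
    grU (mcoeff x f * mcoeff y g) (x * y)%g.

Lemma grU0 x : grU 0 x = 0.
Proof. exact: monalgU0. Qed.

Lemma grUD c d x : grU (c + d) x = grU c x + grU d x.
Proof. exact: monalgUD. Qed.

Lemma grE (f : RG) : f = \sum_(x <- msupp f) grU (mcoeff x f) x.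
Proof. exact: monalgE. Qed.

Lemma grmulw (d1 d2 : {fset G}) (f g : RG) :
  (msupp f `<=` d1)%fset -> (msupp g `<=` d2)%fset ->
  grmul f g = \sum_(x <- d1) \sum_(y <- d2)
    grU (mcoeff x f * mcoeff y g) (x * y)%g.
Proof.
move=> le1 le2; rewrite /grmul (big_fset_incl _ le1) /=.
  apply: eq_bigr => x _; apply: big_fset_incl => // y _ /mcoeff_outdom ->.
  by rewrite mulr0 grU0.
move=> x _ /mcoeff_outdom fx.
by rewrite big1 // => y _; rewrite fx mul0r grU0.
Qed.

Fact grmulDl : left_distributive grmul +%R.
Proof.
move=> f g h.
rewrite [in RHS](grmulw (fsubsetUl _ (msupp g)) (fsubset_refl _)).
rewrite [in RHS](grmulw (fsubsetUr (msupp f) _) (fsubset_refl _)).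
rewrite (grmulw (msuppD_le _ _) (fsubset_refl _)).
rewrite -big_split /=; apply: eq_bigr => x _.
rewrite -big_split /=; apply: eq_bigr => y _.
by rewrite mcoeffD mulrDl grUD.
Qed.

Fact grmulDr : right_distributive grmul +%R.
Proof.
move=> h f g.
rewrite [in RHS](grmulw (fsubset_refl _) (fsubsetUl _ (msupp g))).
rewrite [in RHS](grmulw (fsubset_refl _) (fsubsetUr (msupp f) _)).
rewrite (grmulw (fsubset_refl _) (msuppD_le _ _)).
rewrite -big_split /=; apply: eq_bigr => x _.
rewrite -big_split /=; apply: eq_bigr => y _.
by rewrite mcoeffD mulrDr grUD.
Qed.

Lemma grmul0 : left_zero (0 : RG) grmul.
Proof. by move=> f; rewrite /grmul msupp0 big_seq_fset0. Qed.

Lemma grmulr0 : right_zero (0 : RG) grmul.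
Proof.
by move=> f; rewrite /grmul msupp0 big1 // => x _; rewrite big_seq_fset0.
Qed.

Lemma grmulUU c d x y : grmul (grU c x) (grU d y) = grU (c * d) (x * y)%g.
Proof.
rewrite (grmulw msuppU_le msuppU_le) !big_seq_fset1.
by rewrite /grU !mcoeffUU.
Qed.

Lemma grmul_suml (I : Type) (r : seq I) (F : I -> RG) g :
  grmul (\sum_(i <- r) F i) g = \sum_(i <- r) grmul (F i) g.
Proof. exact: (big_morph (grmul^~ g) (fun x y => grmulDl x y g) (grmul0 g)). Qed.

Lemma grmul_sumr (I : Type) (r : seq I) (F : I -> RG) g :
  grmul g (\sum_(i <- r) F i) = \sum_(i <- r) grmul g (F i).
Proof. exact: (big_morph (grmul g) (grmulDr g) (grmulr0 g)). Qed.

Fact grmulA : associative grmul.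
Proof.
move=> f g h; rewrite (grE f) !grmul_suml; apply: eq_bigr => x _.
rewrite (grE g) grmul_suml !grmul_sumr grmul_suml; apply: eq_bigr => y _.
rewrite (grE h) !grmul_sumr; apply: eq_bigr => z _.
by rewrite !grmulUU mulrA mulgA.
Qed.

Fact gr1mul : left_id gr1 grmul.
Proof.
move=> f; rewrite (grE f) grmul_sumr; apply: eq_bigr => x _.
by rewrite grmulUU mul1r mul1g.
Qed.

Fact grmul1 : right_id gr1 grmul.
Proof.
move=> f; rewrite (grE f) grmul_suml; apply: eq_bigr => x _.
by rewrite grmulUU mulr1 mulg1.
Qed.

Fact gr1_neq0 : gr1 != 0.
Proof. by rewrite /gr1 /grU monalgU_eq0 oner_eq0. Qed.

HB.instance Definition _ := GRing.Zmodule_isNzRing.Build RG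
  grmulA gr1mul grmul1 grmulDl grmulDr gr1_neq0.

Definition gr_of (x : G) : RG := grU 1 x.

Lemma gr_of1 : gr_of 1%g = 1.
Proof. by []. Qed.

Lemma gr_ofM x y : gr_of (x * y)%g = gr_of x * gr_of y.
Proof. by rewrite [RHS]grmulUU mulr1. Qed.

End GroupRing.

Arguments gr_of R {G} x.

(** * Virtual braid groups and singular virtual braid monoids *)

(* The indices 1, ..., n-1 are represented by ['I_n.-1], i.e. shifted by one. *)

Inductive vb_gen (n : nat) := VSigma of 'I_n.-1 | VRho of 'I_n.-1.

Inductive svb_gen (n : nat) :=
  | SSigma of 'I_n.-1 | SSigmaV of 'I_n.-1 | SRho of 'I_n.-1 | STau of 'I_n.-1.

Section GenChoice.
Context (n : nat).

Definition vb_gen_code (x : vb_gen n) : 'I_n.-1 + 'I_n.-1 :=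
  match x with VSigma i => inl i | VRho i => inr i end.

Definition vb_gen_decode (x : 'I_n.-1 + 'I_n.-1) : vb_gen n :=
  match x with inl i => VSigma i | inr i => VRho i end.

Lemma vb_gen_codeK : cancel vb_gen_code vb_gen_decode.
Proof. by case. Qed.

HB.instance Definition _ := Choice.copy (vb_gen n) (can_type vb_gen_codeK).

Definition svb_gen_code (x : svb_gen n) :
    ('I_n.-1 + 'I_n.-1) + ('I_n.-1 + 'I_n.-1) :=
  match x with
  | SSigma i => inl (inl i) | SSigmaV i => inl (inr i)
  | SRho i => inr (inl i) | STau i => inr (inr i)
  end.

Definition svb_gen_decode (x : ('I_n.-1 + 'I_n.-1) + ('I_n.-1 + 'I_n.-1)) :
    svb_gen n :=
  match x with
  | inl (inl i) => SSigma i | inl (inr i) => SSigmaV i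
  | inr (inl i) => SRho i | inr (inr i) => STau i
  end.

Lemma svb_gen_codeK : cancel svb_gen_code svb_gen_decode.
Proof. by case. Qed.

HB.instance Definition _ := Choice.copy (svb_gen n) (can_type svb_gen_codeK).

End GenChoice.

Definition far (m : nat) (i j : 'I_m) : bool := (2 <= `|i%:Z - j%:Z|)%N.

(* The relations common to both presentations, for letters [s i], [r i] playing
   the roles of sigma_i, rho_i. *)
Inductive virtual_rel (n : nat) (L : Type) (s r : 'I_n.-1 -> L) :
    seq L -> seq L -> Prop :=
| rel_R0 (i j : 'I_n.-1) : far i j ->
    virtual_rel s r [:: s i; s j] [:: s j; s i]
| rel_R3 (i j : 'I_n.-1) : j = i.+1 :> nat ->
    virtual_rel s r [:: s i; s j; s i] [:: s j; s i; s j]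
| rel_V1 (i j : 'I_n.-1) : far i j ->
    virtual_rel s r [:: r i; r j] [:: r j; r i]
| rel_V2 (i j : 'I_n.-1) : far i j ->
    virtual_rel s r [:: s i; r j] [:: r j; s i]
| rel_V3 (i : 'I_n.-1) :
    virtual_rel s r [:: r i; r i] [::]
| rel_V4 (i j : 'I_n.-1) : j = i.+1 :> nat ->
    virtual_rel s r [:: r i; r j; r i] [:: r j; r i; r j]
| rel_V5 (i j : 'I_n.-1) : j = i.+1 :> nat ->
    virtual_rel s r [:: r i; s j; r i] [:: r j; s i; r j].

Definition vb_rel (n : nat) :
    seq (vb_gen n * bool) -> seq (vb_gen n * bool) -> Prop :=
  virtual_rel (fun i => (VSigma i, true)) (fun i => (VRho i, true)).

Inductive svb_rel (n : nat) : seq (svb_gen n) -> seq (svb_gen n) -> Prop :=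
| rel_virtual u v :
    virtual_rel (@SSigma n) (@SRho n) u v -> svb_rel u v
| rel_R2r i :
    svb_rel [:: SSigma i; SSigmaV i] [::]
| rel_R2l i :
    svb_rel [:: SSigmaV i; SSigma i] [::]
| rel_S1 (i j : 'I_n.-1) : far i j ->
    svb_rel [:: STau i; STau j] [:: STau j; STau i]
| rel_S2 (i j : 'I_n.-1) : far i j ->
    svb_rel [:: STau i; SSigma j] [:: SSigma j; STau i]
| rel_S3 i :
    svb_rel [:: STau i; SSigma i] [:: SSigma i; STau i]
| rel_S4 (i j : 'I_n.-1) : j = i.+1 :> nat ->
    svb_rel [:: SSigma i; SSigma j; STau i] [:: STau j; SSigma i; SSigma j]
| rel_SV1 (i j : 'I_n.-1) : far i j ->
    svb_rel [:: SRho i; STau j] [:: STau j; SRho i]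
| rel_SV2 (i j : 'I_n.-1) : j = i.+1 :> nat ->
    svb_rel [:: SRho i; STau j; SRho i] [:: SRho j; STau i; SRho j].

Section Desingularization.
Context (n : nat).

Definition VB := presented_group (@vb_rel n).
HB.instance Definition _ := Group.on VB.

Definition SVB := presented_monoid (@svb_rel n).
HB.instance Definition _ := monoid.Monoid.on SVB.

Definition ZVB := group_ring int VB.
HB.instance Definition _ := GRing.NzRing.on ZVB.

Definition vsigma (i : 'I_n.-1) : VB := group_gen (@vb_rel n) (VSigma i).
Definition vrho (i : 'I_n.-1) : VB := group_gen (@vb_rel n) (VRho i).

Definition sgen (x : svb_gen n) : SVB := word_class (@svb_rel n) [:: x].

Definition desing_gen (x : svb_gen n) : ZVB :=
  match x with
  | SSigma i => gr_of int (vsigma i)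
  | SSigmaV i => gr_of int (vsigma i)^-1%g
  | SRho i => gr_of int (vrho i)
  | STau i => gr_of int (vsigma i) - gr_of int (vsigma i)^-1%g
  end.

Definition desing_word (u : seq (svb_gen n)) : ZVB := \prod_(x <- u) desing_gen x.

(* The value does not depend on the representative, see [desing_class]; [desing]
   is multiplicative, see [desing1] and [desingM]. *)
Definition desing (x : SVB) : ZVB := desing_word (repr x).

Local Notation s := vsigma.
Local Notation r := vrho.

Definition vletter (x : vb_gen n * bool) : VB :=
  word_class (group_rel (@vb_rel n)) [:: x].

Lemma vb_relP u v : vb_rel u v ->
  (\prod_(x <- u) vletter x = \prod_(x <- v) vletter x)%g.
Proof.
move=> uv; rewrite -!(word_class_prod (group_rel (@vb_rel n))).
exact/word_classP/word_cong_rel/group_rel_gen.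
Qed.

Lemma vsigmaC i j : far i j -> (s i * s j = s j * s i)%g.
Proof. by move=> h; have := vb_relP (rel_R0 _ _ h);
  rewrite !big_cons !big_nil !mulgA !mulg1. Qed.

Lemma vsigma_braid (i j : 'I_n.-1) : j = i.+1 :> nat ->
  (s i * s j * s i = s j * s i * s j)%g.
Proof. by move=> h; have := vb_relP (rel_R3 _ _ h);
  rewrite !big_cons !big_nil !mulgA !mulg1. Qed.

Lemma vrhoC i j : far i j -> (r i * r j = r j * r i)%g.
Proof. by move=> h; have := vb_relP (rel_V1 _ _ h);
  rewrite !big_cons !big_nil !mulgA !mulg1. Qed.

Lemma vsigma_rhoC i j : far i j -> (s i * r j = r j * s i)%g.
Proof. by move=> h; have := vb_relP (rel_V2 _ _ h);
  rewrite !big_cons !big_nil !mulgA !mulg1. Qed.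

Lemma vrho2 i : (r i * r i = 1)%g.
Proof. by have := vb_relP (rel_V3 _ _ i);
  rewrite !big_cons !big_nil !mulgA !mulg1. Qed.

Lemma vrho_braid (i j : 'I_n.-1) : j = i.+1 :> nat ->
  (r i * r j * r i = r j * r i * r j)%g.
Proof. by move=> h; have := vb_relP (rel_V4 _ _ h);
  rewrite !big_cons !big_nil !mulgA !mulg1. Qed.

Lemma vrho_sigma (i j : 'I_n.-1) : j = i.+1 :> nat ->
  (r i * s j * r i = r j * s i * r j)%g.
Proof. by move=> h; have := vb_relP (rel_V5 _ _ h);
  rewrite !big_cons !big_nil !mulgA !mulg1. Qed.

Lemma vrhoV i : ((r i)^-1 = r i)%g.
Proof. by apply: (mulgI (r i)); rewrite mulgV vrho2. Qed.

Lemma far_sym m (i j : 'I_m) : far i j = far j i.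
Proof. by rewrite /far distnC. Qed.

Lemma gr_comm x y : (x * y = y * x)%g ->
  GRing.comm (gr_of int x : ZVB) (gr_of int y).
Proof. by rewrite /GRing.comm -!gr_ofM => ->. Qed.

Lemma desing_wordM u v : desing_word (u ++ v) = desing_word u * desing_word v.
Proof. exact: big_cat. Qed.

Lemma desing_word_virtual u v :
  virtual_rel (@SSigma n) (@SRho n) u v -> desing_word u = desing_word v.
Proof.
by case=> [i j ij|i j ij|i j ij|i j ij|i|i j ij|i j ij];
  rewrite /desing_word !big_cons !big_nil /= ?mulr1 ?mulrA -?gr_ofM;
  [rewrite vsigmaC | rewrite vsigma_braid | rewrite vrhoC | rewrite vsigma_rhoC
  |rewrite vrho2 | rewrite vrho_braid | rewrite vrho_sigma].
Qed.

Lemma desing_word_rel u v : svb_rel u v -> desing_word u = desing_word v.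
Proof.
case=> {u v} [u v /desing_word_virtual //|i|i|i j ij|i j ij|i|i j ij|i j ij|
  i j ij];
  rewrite /desing_word !big_cons !big_nil /= ?mulr1.
- by rewrite -gr_ofM mulgV.
- by rewrite -gr_ofM mulVg.
- have cs := vsigmaC ij.
  apply: commrB; apply/commr_sym; apply: commrB; apply: gr_comm => //.
  + exact/commuteV.
  + exact/commute_sym/commuteV.
  + exact/commuteV/commute_sym/commuteV.
- apply/commr_sym; apply: commrB; apply: gr_comm; first exact/commute_sym/vsigmaC.
  exact/commuteV/commute_sym/vsigmaC.
- by apply/commr_sym; apply: commrB; apply: gr_comm; rewrite ?mulgV ?mulVg.
- rewrite !mulrA mulrBr !mulrBl -!gr_ofM (vsigma_braid ij); congr (_ - _).
  congr (gr_of int _); apply: (mulgI (s j)); apply: (mulIg (s i)).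
  by rewrite !mulgA mulgVK mulgV mul1g (vsigma_braid ij).
- rewrite far_sym in ij; have cs := vsigma_rhoC ij.
  apply: commrB; apply: gr_comm; first exact/commute_sym.
  exact/commuteV/commute_sym.
- rewrite !(mulrBr, mulrBl) -!gr_ofM; congr (_ - _); congr (gr_of int _).
    by rewrite !mulgA vrho_sigma.
  apply: (can_inj invgK); rewrite !invgM !invgK !vrhoV.
  exact: vrho_sigma.
Qed.

Lemma desing_word_cong u v :
  word_cong (@svb_rel n) u v -> desing_word u = desing_word v.
Proof.
elim=> {u v} [u v /desing_word_rel //|//|//|v u w _ -> _ //|u u' v v' _ + _].
by rewrite !desing_wordM => -> ->.
Qed.

Lemma desing_class u : desing (word_class (@svb_rel n) u) = desing_word u.
Proof. exact/desing_word_cong/word_cong_repr. Qed.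

Lemma desing1 : desing 1%g = 1.
Proof. by rewrite -word_class_nil desing_class /desing_word big_nil. Qed.

Lemma desingM x y : desing (x * y)%g = desing x * desing y.
Proof.
rewrite -(word_class_repr x) -(word_class_repr y) -word_class_cat.
by rewrite !desing_class desing_wordM.
Qed.

Lemma desing_sgen x : desing (sgen x) = desing_gen x.
Proof. by rewrite desing_class /desing_word big_seq1. Qed.

End Desingularization.

(* Main.v *)
Require Import Defs.
From mathcomp Require Import all_boot all_order all_algebra.
From mathcomp Require Import boolp classical_sets.
From mathcomp Require Import monalg.

(** An element of [SVB n] is the class of a word [u]; the value of [desing] on it
    is the product of the images of the letters.

    For an invertible [t] in a field, giving weight [t] to every sigma and
    weight [1] to every rho respects all relations of [VB n], since both sides
    of each relation contain equally many sigmas. It thus extends to a ring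
    morphism [gr_weight t] from the group ring to the field, under which a
    letter tau goes to [t - t^-1]. Suppose that [u] contains a tau and that its
    image is the integer [a]. The weight at [t = 1], the augmentation, kills
    tau, so [a = 0]; the weight at [t = 2] gives [3/2] to tau and is nonzero on
    every letter, so [a <> 0] ([desing_word_neq_int]).

    Hence [u] has no tau, and its image is a single group element
    ([desing_word_no_tau]). Augmentation forces [a = 1], so this element is the
    unit of [VB n]. Finally, every relation of [VB n] also holds in [SVB n]
    ([svb_letter_cong]), so a word without tau that is trivial in [VB n] is
    already trivial in [SVB n]. *)

Set Implicit Arguments.
Unset Strict Implicit.
Unset Printing Implicit Defensive.

Import GRing.Theory.

Local Open Scope ring_scope.
Local Open Scope classical_set_scope.

Lemma word_cong_prod (A : Type) (R : seq A -> seq A -> Prop) (M : pzSemiRingType)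
    (f : A -> M) :
    (forall u v, R u v -> \prod_(x <- u) f x = \prod_(x <- v) f x) ->
  forall u v, word_cong R u v -> \prod_(x <- u) f x = \prod_(x <- v) f x.
Proof.
move=> fR u v; elim=> {u v} [|//|//|v u w _ -> _ //|u u' v v' _ + _ +].
  exact: fR.
by rewrite !big_cat /= => -> ->.
Qed.

Lemma word_cong_map (A B : Type) (R : seq A -> seq A -> Prop)
    (S : seq B -> seq B -> Prop) (f : A -> B) :
    (forall u v, R u v -> word_cong S (map f u) (map f v)) ->
  forall u v, word_cong R u v -> word_cong S (map f u) (map f v).
Proof.
move=> fR u v; elim=> {u v} [|u|u v _|v u w _ uv _|u u' v v' _ uu _ vv].
- exact: fR.
- exact: word_cong_refl.
- exact: word_cong_sym.
- exact: word_cong_trans uv.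
- by rewrite !map_cat; apply: word_cong_cat.
Qed.

Lemma mmap_gr_of (R S : nzRingType) (G : groupType) (f : {rmorphism R -> S})
    (h : G -> S) x :
  mmap f h (gr_of R x) = h x.
Proof. by rewrite mmapU /= rmorph1 mul1r. Qed.

(** Commutativity of [S] lets the values of [h] move past the coefficients. *)
Lemma mmap_grM (R : nzRingType) (S : comNzRingType) (G : groupType)
    (f : {rmorphism R -> S}) (h : G -> S) :
    (forall x y, h (x * y)%g = h x * h y) ->
  forall a b : group_ring R G, mmap f h (a * b) = mmap f h a * mmap f h b.
Proof.
move=> hM a b; rewrite [in RHS]mmapE mulr_suml.
rewrite [a * b]/(grmul a b) /grmul raddf_sum /=; apply: eq_bigr => x _.
rewrite [mmap f h b]mmapE mulr_sumr raddf_sum /=; apply: eq_bigr => y _.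
by rewrite mmapU /= rmorphM hM mulrACA.
Qed.

Section SigmaWeight.
Context (n : nat) (F : fieldType) (t : F) (t0 : t != 0).

Definition letter_weight (x : vb_gen n * bool) : F :=
  match x with
  | (VSigma _, true) => t
  | (VSigma _, false) => t^-1
  | (VRho _, _) => 1
  end.

Definition sigma_weight (x : VB n) : F := \prod_(a <- repr x) letter_weight a.

(** The relations of [VB n] preserve the weight: they preserve the number of
    sigmas, and the cancellation rule uses that [t] is invertible. *)
Lemma sigma_weight_class u :
  sigma_weight (word_class (group_rel (@vb_rel n)) u) =
  \prod_(a <- u) letter_weight a.
Proof.
apply: (@word_cong_prod _ (group_rel (@vb_rel n))); last exact: word_cong_repr.
move=> {}u v [{}u {}v []|[i|i] []] *;
  by rewrite !big_cons !big_nil /= ?mulr1 ?mul1r ?mulfV ?mulVf.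
Qed.

Lemma sigma_weightM x y :
  sigma_weight (x * y)%g = sigma_weight x * sigma_weight y.
Proof.
rewrite -(word_class_repr x) -(word_class_repr y) -word_class_cat.
by rewrite !sigma_weight_class big_cat.
Qed.

(** The linear extension of [sigma_weight]; for [t = 1] it is the augmentation. *)
Definition gr_weight : ZVB n -> F := mmap intr sigma_weight.

Lemma gr_weight_of x : gr_weight (gr_of int x) = sigma_weight x.
Proof. exact: mmap_gr_of. Qed.

Lemma gr_weight1 : gr_weight 1 = 1.
Proof.
by rewrite -[1]/(gr_of int 1%g) gr_weight_of -word_class_nil sigma_weight_class
  big_nil.
Qed.

Lemma gr_weight_int (a : int) : gr_weight a%:~R = a%:~R.
Proof. by rewrite /gr_weight raddfMz /= -/(gr_weight 1) gr_weight1. Qed.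

Lemma gr_weight_desing u :
  gr_weight (desing_word u) = \prod_(x <- u) gr_weight (desing_gen x).
Proof.
apply: (big_morph gr_weight _ gr_weight1) => a b.
exact: (mmap_grM _ sigma_weightM).
Qed.

Lemma gr_weight_gen x :
  gr_weight (desing_gen x) =
  match x with
  | SSigma _ => t
  | SSigmaV _ => t^-1
  | SRho _ => 1
  | STau _ => t - t^-1
  end.
Proof.
have wV i : sigma_weight (vsigma i)^-1%g = t^-1.
  by rewrite group_genV sigma_weight_class big_seq1.
have w i : sigma_weight (group_gen (@vb_rel n) i) = letter_weight (i, true).
  by rewrite sigma_weight_class big_seq1.
case: x => i /=; rewrite ?gr_weight_of ?w ?wV //.
rewrite [LHS]raddfB /= -!/(gr_weight _).
by rewrite !gr_weight_of w wV.
Qed.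

End SigmaWeight.

Definition is_tau n (x : svb_gen n) : bool := if x is STau _ then true else false.

(** The value at a tau is a dummy: this translation is meant for words without
    tau, on which [svb_letter] undoes it. *)
Definition vb_letter n (x : svb_gen n) : vb_gen n * bool :=
  match x with
  | SSigma i => (VSigma i, true)
  | SSigmaV i => (VSigma i, false)
  | SRho i | STau i => (VRho i, true)
  end.

(** A rho is an involution, so both signs of it are sent to the same letter. *)
Definition svb_letter n (x : vb_gen n * bool) : svb_gen n :=
  match x with
  | (VSigma i, true) => SSigma i
  | (VSigma i, false) => SSigmaV i
  | (VRho i, _) => SRho i
  end.

Lemma vb_letterK n (u : seq (svb_gen n)) :
  ~~ has (@is_tau n) u -> map (@svb_letter n) (map (@vb_letter n) u) = u.
Proof.
rewrite -all_predC => /allP no_tau; rewrite -map_comp.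
by apply: map_id_in => -[] i /no_tau.
Qed.

(** This is the well-definedness of the natural morphism from [VB n] to [SVB n]:
    the relations of [VB n] are among those of [SVB n], where also each sigma has
    an inverse letter and each rho is an involution. *)
Lemma svb_letter_cong n (u v : seq (vb_gen n * bool)) :
  word_cong (group_rel (@vb_rel n)) u v ->
  word_cong (@svb_rel n) (map (@svb_letter n) u) (map (@svb_letter n) v).
Proof.
apply: word_cong_map => {}u {}v [{}u {}v uv|[i|i] []];
  apply: word_cong_rel; try by constructor.
- by apply: rel_virtual; case: uv => *; constructor.
- exact/rel_virtual/rel_V3.
- exact/rel_virtual/rel_V3.
Qed.

(** Without tau no sum appears, so the image stays a group element. *)
Lemma desing_word_no_tau n (u : seq (svb_gen n)) :
  ~~ has (@is_tau n) u ->
  desing_word u =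
  gr_of int
    (word_class (group_rel (@vb_rel n)) (map (@vb_letter n) u) : VB n).
Proof.
elim: u => [_|x u IHu]; first by rewrite /desing_word big_nil.
rewrite /= negb_or => /andP[x_tau /IHu u_eq].
rewrite -[vb_letter x :: _]cat1s word_class_cat gr_ofM -u_eq /desing_word big_cons.
by congr (_ * _); case: x x_tau => // i _; rewrite /= group_genV.
Qed.

Lemma gr_of_inj (G : groupType) : injective (@gr_of int G).
Proof.
move=> x y /(congr1 (mcoeff x)); rewrite !mcoeffU eqxx.
by case: eqVneq => // ->.
Qed.

(** The weight at [t = 1] vanishes on a tau, which leaves only [a = 0]; a weight
    with [t ^+ 2 != 1], such as [t = 2], vanishes on no letter and excludes it. *)
Lemma desing_word_neq_int n (u : seq (svb_gen n)) (a : int) :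
  has (@is_tau n) u -> desing_word u <> a%:~R.
Proof.
move=> u_tau u_a.
have a0 : a = 0.
  have /eqP := congr1 (gr_weight (1 : rat)) u_a.
  rewrite gr_weight_int ?oner_eq0 // gr_weight_desing ?oner_eq0 // => /eqP w_eq.
  apply/eqP; rewrite -(intr_eq0 rat) -w_eq prodf_seq_eq0.
  apply: sub_has u_tau => x; rewrite /= gr_weight_gen ?oner_eq0 //.
  by case: x => // i _; rewrite invr1 subrr.
have := congr1 (gr_weight (2 : rat)) u_a.
rewrite gr_weight_int // gr_weight_desing // a0 => /eqP.
rewrite prodf_seq_eq0 => /hasP[x _ /=].
by rewrite gr_weight_gen //; case: x.
Qed.

Theorem proposition3 (n : nat) (hn : (2 <= n)%N) (a : int) :
  @desing n @^-1` [set a%:~R : ZVB n] =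
  if a == 1 then [set 1%g : SVB n] else set0.
Proof.
rewrite predeqE => x; split=> [x_a|]; last first.
  by case: eqP => [-> /= ->|_ []]; rewrite /= desing1.
have {}x_a : desing_word (repr x) = a%:~R by exact: x_a.
have no_tau : ~~ has (@is_tau n) (repr x).
  by apply/negP => /desing_word_neq_int/(_ x_a).
have a1 : a = 1.
  have := congr1 (gr_weight (1 : rat)) x_a.
  rewrite gr_weight_int ?oner_eq0 // gr_weight_desing ?oner_eq0 // => w_eq.
  apply/eqP; rewrite -(eqr_int rat) -w_eq big_seq big1 // => y y_x.
  have := hasPn no_tau y y_x.
  by rewrite gr_weight_gen ?oner_eq0 //; case: y y_x => // *; rewrite invr1.
rewrite a1 eqxx /=; move: x_a; rewrite a1 desing_word_no_tau //.
move=> /gr_of_inj /word_classP /svb_letter_cong.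
rewrite vb_letterK // => x_nil.
by rewrite -(word_class_repr x); apply/word_classP.
Qed.
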